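(* Let $G^{(n)}$ be a family of random undirected graphs on $n$ vertices such that: (Property 1) for some constant $K$ independent of $n$, w.h.p. $d^{(n)}_{\max}/d^{(n)}_{\min}\le K$, where $d^{(n)}_{\max}$ and $d^{(n)}_{\min}$ are the maximum and minimum degrees of $G^{(n)}$; (Property 2) w.h.p. $\max\{|\lambda_2^{(n)}|,|\lambda_n^{(n)}|\}=o(1)$, where $1=\lambda_1^{(n)}\ge\lambda_2^{(n)}\ge\dots\ge\lambda_n^{(n)}$ are the eigenvalues of $\mathbf Q^{(n)}=\mathbf D^{-1/2}\mathbf A\mathbf D^{-1/2}$. Let $\alpha\in[0,1]$ be a fixed damping factor and let $\mathbf v=\mathbf v^{(n)}$ be preference (probability) vectors with $\|\mathbf v\|_2=O(1/\sqrt n)$. Let $\boldsymbol\pi^{(n)}$ be the PageRank vector of $G^{(n)}$ with damping factor $\alpha$ and preference vector $\mathbf v$, and let $$\overline{\boldsymbol\pi}^{(n)}=\frac{\alpha\,\mathbf d^{(n)}}{\mathrm{vol}(G^{(n)})}+(1-\alpha)\mathbf v,\qquad \mathrm{vol}(G^{(n)})=\sum_i d_i^{(n)}.$$ Then w.h.p. $$d_{TV}(\boldsymbol\pi^{(n)},\overline{\boldsymbol\pi}^{(n)})=o(1)\quad\text{as } n\to\infty .$$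
   Context: Graphs are undirected and unweighted. $\mathbf A=\mathbf A^{(n)}$ is the symmetric $0/1$ adjacency matrix, $\mathbf 1$ the all-ones column vector, $\mathbf d=\mathbf A\mathbf 1$ the vector of degrees $d_i=\sum_j A_{ij}$, $\mathbf D=\mathrm{diag}(\mathbf d)$. $\mathbf P=\mathbf A\mathbf D^{-1}$ is the column-stochastic transition matrix of the simple random walk. These matrices, and Properties 1 and 2, presuppose that all degrees are positive (w.h.p.). PageRank: for a probability vector $\mathbf v\in\mathbb R^n$ (nonnegative entries summing to 1, deterministic), the PageRank vector $\boldsymbol\pi$ is the stationary probability vector of $\widetilde{\mathbf P}=\alpha\mathbf P+(1-\alpha)\mathbf v\mathbf 1^T$, i.e. $\boldsymbol\pi=\widetilde{\mathbf P}\boldsymbol\pi$, $\mathbf 1^T\boldsymbol\pi=1$. For $\alpha<1$ it equals $(1-\alpha)[\mathbf I-\alpha\mathbf P]^{-1}\mathbf v$; for $\alpha=1$ it is the stationary distribution of the simple random walk (unique when the graph is connected, which Property 2 guarantees w.h.p.). Total variation distance: $d_{TV}(u,v)=\frac12\sum_i|u_i-v_i|$. $\|\mathbf x\|_2=\sqrt{\sum_i|x_i|^2}$. An event (depending on $n$) holds with high probability (w.h.p.) if there are $N$ and $c>0$ such that its probability is at least $1-O(n^{-c})$ for all $n>N$. Nonnegative random variables $X_n$ satisfy $X_n=o(1)$ w.h.p. if there is a deterministic function $\psi(n)=o(1)$ such that the event $\{X_n\le\psi(n)\}$ holds w.h.p. *)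

(* Defs.v *)
From HB Require Import structures.
From mathcomp Require Import all_boot all_order all_algebra.
From mathcomp Require Import all_classical all_reals all_analysis.

Set Implicit Arguments.
Unset Strict Implicit.
Unset Printing Implicit Defensive.

Import Order.TTheory GRing.Theory Num.Theory.
Import numFieldNormedType.Exports.

Local Open Scope classical_set_scope.
Local Open Scope ring_scope.

(* Irreflexivity is not imposed: a loop at i contributes 1 to A i i, hence 1 to
   the degree of i. *)
Record ugraph (n : nat) := UGraph {
  adj :> rel 'I_n;
  adj_sym : symmetric adj }.

Section Vectors.
Variable R : realType.

Definition ones (n : nat) : 'cV[R]_n := const_mx 1.

Definition prob_vec (n : nat) (x : 'cV[R]_n) : Prop :=
  (forall i, 0 <= x i 0) /\ \sum_i x i 0 = 1.

Definition dTV (n : nat) (x y : 'cV[R]_n) : R :=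
  2^-1 * \sum_i `|x i 0 - y i 0|.

(* The norm `|x| of the library is the sup norm. *)
Definition norm2 (n : nat) (x : 'cV[R]_n) : R :=
  Num.sqrt (\sum_i `|x i 0| ^+ 2).

(* With multiplicity, in nonincreasing order: there is at most one such list, and
   there is one whenever M is symmetric. *)
Definition eigenvalues (n : nat) (M : 'M[R]_n) : seq R :=
  xget [::] [set s : seq R | sorted >=%R s /\
                             char_poly M = \prod_(x <- s) ('X - x%:P)].

(* Indexed from 1: eigval M 1 is the largest eigenvalue. *)
Definition eigval (n : nat) (M : 'M[R]_n) (k : nat) : R := (eigenvalues M)`_k.-1.

End Vectors.

Section Graphs.
Variables (R : realType) (n : nat).
Implicit Type g : ugraph n.

Definition adjmx g : 'M[R]_n := \matrix_(i, j) (g i j)%:R.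

Definition degv g : 'cV[R]_n := adjmx g *m ones R n.

Definition degmx g : 'M[R]_n := diag_mx (degv g)^T.

Definition vol g : R := \sum_i degv g i 0.

Definition dmax g : R := \big[Num.max/0]_i degv g i 0.

(* Every degree is at most n, so for n > 0 the default n%:R is harmless. *)
Definition dmin g : R := \big[Num.min/n%:R]_i degv g i 0.

Definition degmx_isqrt g : 'M[R]_n :=
  diag_mx (\row_i (Num.sqrt (degv g i 0))^-1).

Definition Qmx g : 'M[R]_n := degmx_isqrt g *m adjmx g *m degmx_isqrt g.

Definition max_lambda2n g : R :=
  Num.max `|eigval (Qmx g) 2| `|eigval (Qmx g) n|.

Definition Pmx g : 'M[R]_n := adjmx g *m invmx (degmx g).

Definition Pmx_tilde (alpha : R) (v : 'cV[R]_n) g : 'M[R]_n :=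
  alpha *: Pmx g + (1 - alpha) *: (v *m (ones R n)^T).

(* If all degrees are positive and v is a probability vector (0 <= alpha <= 1),
   a stationary probability vector exists; it is unique if moreover
   alpha < 1 or the graph is connected. *)
Definition pagerank (alpha : R) (v : 'cV[R]_n) g : 'cV[R]_n :=
  xget 0 [set p : 'cV[R]_n | prob_vec p /\ p = Pmx_tilde alpha v g *m p].

Definition pagerank_limit (alpha : R) (v : 'cV[R]_n) g : 'cV[R]_n :=
  (alpha / vol g) *: degv g + (1 - alpha) *: v.

End Graphs.

Section WithHighProbability.
Variables (R : realType) (disp : nat -> measure_display).
Variables (Omega : forall n, measurableType (disp n)).
Variables (P : forall n, probability (Omega n) R).

(* ugraph n has finitely many elements up to extensional equality of adj, so
   measurability of the edge events makes every event expressed through the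
   adjacency matrix of G n measurable. *)
Definition random_graph (G : forall n, Omega n -> ugraph n) : Prop :=
  forall n (i j : 'I_n), measurable [set w | G n w i j].

Definition whp (E : forall n, set (Omega n)) : Prop :=
  exists (N : nat) (c C : R), 0 < c /\
    forall n, (N < n)%N -> ((1 - C * n%:R `^ (- c))%:E <= P n (E n))%E.

Definition whp_o1 (X : forall n, Omega n -> R) : Prop :=
  exists psi : nat -> R, psi @ \oo --> (0 : R) /\
    whp (fun n => [set w | X n w <= psi n]).

End WithHighProbability.

(* Main.v *)
Require Import Defs.
From HB Require Import structures.
From mathcomp Require Import all_boot all_order all_algebra.
From mathcomp Require Import all_classical all_reals all_analysis.
From mathcomp Require Import complex.
From mathcomp Require Import ring lra.

(** PageRank mixes in one step.  Let s = d / vol be the stationary vector of the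
    undamped walk, pi the PageRank vector, y = pi - s and w = v - s.  Since
    P s = s, the fixed-point equation for pi gives
    y = alpha P y + (1 - alpha) w, and the error to be estimated is exactly
    pi - (alpha s + (1 - alpha) v) = alpha P y: one more step of the walk
    applied to y.  As y has total mass 0, this step is strongly contracting.

    To see it, put z = D^(-1/2) y.  Then D^(-1/2) P y = Q z with Q symmetric, and
    mass 0 of y says that z is orthogonal to the eigenvector u = D^(1/2) 1 of Q
    for the eigenvalue 1.  If |lambda_2|, |lambda_n| <= eps < 1, then every other
    eigenvalue of Q is at most eps in absolute value, hence |Q z| <= eps |z|
    ([spectral_gap_contraction]).  The same inequality bounds z itself: z is the
    convex combination alpha Q z + (1 - alpha) D^(-1/2) w, so for eps <= 1/2 its
    norm is at most a constant times |D^(-1/2) w|.  Cauchy-Schwarz passes from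
    the 2-norm to total variation at the cost of sqrt n, and this factor is
    absorbed by |v| <= C / sqrt n and by d_i / vol <= K / n; the bounded degree
    ratio also pays for the two changes of weight by D^(1/2).  The result is the
    deterministic inequality dTV <= eps sqrt (K (C^2 + K^2))
    ([pagerank_dTV_le]), valid on every graph in the three good events.

    The definitions pick PageRank vectors and lists of eigenvalues by choice, so
    their existence has to be proved.  For PageRank, P is an l1-contraction, hence
    I - alpha P is invertible for alpha < 1, and the solution has l1-norm at most
    its total mass, hence is nonnegative ([pagerankP]); for alpha = 1, s will
    do.  For eigenvalues it is the spectral theorem, obtained through the complex
    numbers ([symmetric_spectral]).

    Finally, the good events are intersected by a union bound.  Every event about
    the graph is measurable since it is a finite union of cylinder events
    ([measurable_graph_event]). *)

Set Implicit Arguments.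
Unset Strict Implicit.
Unset Printing Implicit Defensive.

Import Order.TTheory GRing.Theory Num.Theory.
Import numFieldNormedType.Exports.

Local Open Scope classical_set_scope.
Local Open Scope ring_scope.

(** * Spectra of real symmetric matrices *)

Local Notation toC := (real_complex _).

(** The eigenvector basis is complex: a symmetric real matrix is Hermitian over
    R[i], where the spectral theorem gives a unitary U.  Its eigenvalues are real,
    so the factorization of the characteristic polynomial descends to R. *)
Lemma symmetric_spectral (R : rcfType) n (A : 'M[R]_n) : A^T = A ->
  exists (U : 'M[complex R]_n) (d : 'rV[R]_n),
    [/\ U \is spectral.unitarymx,
        map_mx toC A = invmx U *m diag_mx (map_mx toC d) *m U &
        char_poly A = \prod_(i < n) ('X - (d 0 i)%:P)].
Proof.
move=> Asym; set AC := map_mx toC A.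
have AH : AC \is hermitianmx n false Num.conj.
  apply: spectral.realsym_hermsym.
    apply/is_hermitianmxP; rewrite expr0 scale1r map_mx_id // /AC.
    by rewrite map_trmx Asym.
  by apply/mxOverP => i j; rewrite mxE complex_real.
have /spectral.hermitian_normalmx/spectral.orthomx_spectralP AE := AH.
pose U := spectral.spectralmx AC.
pose d := map_mx (@complex.Re R) (spectral.spectral_diag AC).
have dE : map_mx toC d = spectral.spectral_diag AC.
  apply/rowP => i; rewrite !mxE RRe_real //.
  by have /mxOverP := spectral.hermitian_spectral_diag_real AH; apply.
have AUE : AC = invmx U *m diag_mx (map_mx toC d) *m U by rewrite dE.
exists U, d; split=> //; first exact: spectral.spectral_unitarymx.
apply: (@map_poly_inj _ _ toC).
have Uu : U \in unitmx := spectral.spectral_unit AC.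
rewrite map_char_poly /= -/AC rmorph_prod /=.
have -> : char_poly AC = char_poly (diag_mx (map_mx toC d)).
  rewrite /char_poly /char_poly_mx AUE !map_mxM map_invmx.
  have UPu : map_mx polyC U \in unitmx by rewrite map_unitmx.
  set UP := map_mx polyC U; set DP := map_mx _ _.
  have -> : 'X%:M - invmx UP *m DP *m UP = invmx UP *m ('X%:M - DP) *m UP.
    by rewrite mulmxBr mulmxBl scalar_mxC -[X in _ = X - _]mulmxA mulVmx // mulmx1.
  rewrite !det_mulmx mulrC mulrA -det_mulmx mulmxV // det1 mul1r //.
rewrite char_poly_trig ?diag_mx_is_trig //.
apply: eq_bigr => i _; rewrite rmorphB /= map_polyX map_polyC /=.
by rewrite !mxE eqxx mulr1n.
Qed.

(** Sorting the diagonal provides the list that [eigenvalues] chooses, and unique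
    factorization makes every such list a permutation of the diagonal. *)
Lemma eigenvalues_spec (R : realType) n (A : 'M[R]_n) (d : 'rV[R]_n) :
  char_poly A = \prod_(i < n) ('X - (d 0 i)%:P) ->
  sorted >=%R (eigenvalues A) /\
  perm_eq (eigenvalues A) [seq d 0 i | i <- enum 'I_n].
Proof.
move=> charA.
have charAs : char_poly A = \prod_(x <- [seq d 0 i | i <- enum 'I_n]) ('X - x%:P).
  by rewrite big_map big_enum.
have [] : [set s : seq R | sorted >=%R s /\
    char_poly A = \prod_(x <- s) ('X - x%:P)] (eigenvalues A).
  apply: (xgetPex [::]); exists (sort >=%R [seq d 0 i | i <- enum 'I_n]); split.
    by apply: sort_sorted => x y; rewrite orbC le_total.
  by rewrite charAs; apply: perm_big; rewrite perm_sym perm_sort.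
by move=> s_sorted charE; split=> //; apply: prod_XsubC_eq; rewrite -charE.
Qed.

(** The second entry cannot be 1, so 1 is the head; the rest lies between the
    last entry and the second one, both of which are small. *)
Lemma sorted_top_gap (R : realDomainType) (s : seq R) (eps : R) :
  sorted >=%R s -> 1 \in s -> eps < 1 ->
  `|s`_1| <= eps -> `|s`_(size s).-1| <= eps ->
  exists2 t, s = 1 :: t & {in t, forall x, `|x| <= eps}.
Proof.
case: s => [//|a t] s_sorted s1 eps1 /= second last.
have ge_trans : transitive (>=%R : rel R) by move=> y x z /= xy yz; exact: le_trans yz xy.
have anti i j : (i <= j)%N -> (j < (size t).+1)%N -> (a :: t)`_j <= (a :: t)`_i.
  move=> ij jt; apply: (sorted_leq_nth ge_trans) => //.
    by move=> x /=; exact: lexx.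
  by rewrite inE (leq_ltn_trans ij).
have small x : x \in t -> `|x| <= eps.
  move=> /(nthP 0) [k kt <-].
  have lo := anti k.+1 (size t) kt (ltnSn _).
  have hi := anti 1%N k.+1 isT kt.
  rewrite ler_norml (le_trans hi (le_trans (ler_norm _) second)) andbT.
  rewrite (le_trans _ lo) // lerNl (le_trans _ last) // -normrN ler_norm //.
exists t => //; congr cons; move: s1; rewrite inE => /predU1P [//|/small].
by rewrite normr1 leNgt eps1.
Qed.

(** Multiplicities matter here: if [a] occurs only once in [a :: t], then it is
    taken by [f] at a single index. *)
Lemma perm_eq_map_enum_head (T : finType) (S : eqType) (f : T -> S) a t :
  perm_eq (a :: t) [seq f i | i <- enum T] ->
  exists2 i0, f i0 = a & forall i, i != i0 -> f i \in t.
Proof.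
move=> s_perm.
have /mapP [i0 _ ai0] : a \in [seq f i | i <- enum T].
  by rewrite -(perm_mem s_perm) mem_head.
exists i0 => // i ne.
have : perm_eq (a :: t) (a :: [seq f i | i <- rem i0 (enum T)]).
  apply: perm_trans s_perm _; rewrite ai0 -map_cons.
  by apply/perm_map/perm_to_rem; rewrite mem_enum.
rewrite perm_cons => /perm_mem ->.
by apply: map_f; rewrite mem_rem_uniq ?enum_uniq // inE ne mem_enum.
Qed.

Lemma unitary_normsq (R : rcfType) n (U : 'M[complex R]_n) (x : 'cV[R]_n) :
  U \is spectral.unitarymx ->
  \sum_i `|(U *m map_mx toC x) i 0| ^+ 2 = toC (\sum_i x i 0 ^+ 2).
Proof.
move=> Uu; set c := U *m _.
have -> : \sum_i `|c i 0| ^+ 2 = (map_mx Num.conj c^T *m c) 0 0.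
  by rewrite mxE; apply: eq_bigr => i _; rewrite !mxE normCK mulrC.
rewrite /c trmx_mul map_mxM mulmxA -[_ *m _ *m U]mulmxA.
rewrite -spectral.invmx_unitary // mulVmx ?spectral.unitarymx_unit // mulmx1.
rewrite mxE rmorph_sum; apply: eq_bigr => i _.
by rewrite !mxE /= conj_Creal ?complex_real// rmorphXn.
Qed.

(** In an orthonormal eigenbasis, u is supported on the eigenvalue 1, which is
    simple because lambda_2 < 1; so u spans a coordinate axis, and x, orthogonal
    to u, has only coordinates on which A acts by factors at most eps. *)
Lemma spectral_gap_contraction (R : realType) n (A : 'M[R]_n) (u x : 'cV[R]_n)
    (eps : R) :
  A^T = A -> A *m u = u -> u != 0 -> \sum_i u i 0 * x i 0 = 0 ->
  eps < 1 -> `|eigval A 2| <= eps -> `|eigval A n| <= eps ->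
  \sum_i (A *m x) i 0 ^+ 2 <= eps ^+ 2 * \sum_i x i 0 ^+ 2.
Proof.
move=> Asym Au u0 ux eps1 eps2 epsn.
have [U [d [Uu AE charA]]] := symmetric_spectral Asym.
have [s_sorted s_perm] := eigenvalues_spec charA.
have Uunit := spectral.unitarymx_unit Uu.
have UA (y : 'cV[R]_n) i : (U *m map_mx toC (A *m y)) i 0 =
    toC (d 0 i) * (U *m map_mx toC y) i 0.
  rewrite map_mxM AE !mulmxA mulmxV // mul1mx -mulmxA.
  by rewrite mul_diag_mx !mxE.
(* The coordinates of u and x in the eigenbasis. *)
pose b := U *m map_mx toC u; pose c := U *m map_mx toC x.
have bd i : d 0 i != 1 -> b i 0 = 0.
  move=> di1; have := UA u i; rewrite Au -/b => /eqP.
  rewrite -[X in X == _]mul1r -subr_eq0 -mulrBl mulf_eq0 subr_eq0 => /predU1P[|/eqP//].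
  by move/(@complexI R) => di; rewrite -di eqxx in di1.
have b0 : b != 0.
  apply: contra_neq u0 => b0; apply: (map_mx_inj (f := toC)).
  by rewrite map_mx0 -(mulKmx Uunit (map_mx _ u)) -/b b0 mulmx0.
have size_s : size (eigenvalues A) = n.
  by rewrite (perm_size s_perm) size_map -cardE card_ord.
have s1 : 1 \in eigenvalues A.
  have [i di] : exists i, d 0 i == 1.
    apply/existsP; apply: contraNT b0 => /existsPn di; apply/eqP/colP => i.
    by rewrite [RHS]mxE bd.
  by rewrite (perm_mem s_perm) -(eqP di) map_f // mem_enum.
have [||t sE t_small] := sorted_top_gap s_sorted s1 eps1; rewrite ?size_s //.
rewrite sE in s_perm.
have [i0 di0 dsmall] := perm_eq_map_enum_head s_perm.
have bE i : i != i0 -> b i 0 = 0.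
  by move=> /dsmall/t_small di; apply: bd; apply: contraTneq di => ->;
    rewrite normr1 -ltNge.
have bi0 : b i0 0 != 0.
  apply: contra_neq b0 => bi0; apply/colP => i; rewrite [RHS]mxE.
  by have [->|/bE] := eqVneq i i0.
have ci0 : c i0 0 = 0.
  have : \sum_i Num.conj (b i 0) * c i 0 = 0.
    have -> : \sum_i Num.conj (b i 0) * c i 0 = (map_mx Num.conj b^T *m c) 0 0.
      by rewrite mxE; apply: eq_bigr => i _; rewrite !mxE.
    rewrite /b /c trmx_mul map_mxM mulmxA -[_ *m _ *m U]mulmxA.
    rewrite -spectral.invmx_unitary // mulVmx // mulmx1 mxE -[RHS](rmorph0 toC) -ux.
    rewrite rmorph_sum; apply: eq_bigr => i _.
    by rewrite !mxE /= conj_Creal ?complex_real// rmorphM.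
  rewrite (bigD1 i0) //= big1 ?addr0 => [|i /bE ->]; last first.
    by rewrite rmorph0 mul0r.
  by move=> /eqP; rewrite mulf_eq0 conjC_eq0 (negPf bi0) => /eqP.
rewrite -(@lecR R) rmorphM /= -!(unitary_normsq _ Uu) mulr_sumr.
apply: ler_sum => i _; rewrite UA -/c.
have [->|/dsmall/t_small di] := eqVneq i i0.
  by rewrite ci0 mulr0 normr0 expr0n /= mulr0.
rewrite normrM exprMn ler_wpM2r ?exprn_ge0 //.
rewrite normc_def /= expr0n addr0 sqrtr_sqr -rmorphXn lecR.
by rewrite lerXn2r ?nnegrE // (le_trans _ di).
Qed.

(** * The random walk and the PageRank vector *)

Section Walk.
Variables (R : realType) (n : nat) (g : ugraph n).
Hypothesis deg_gt0 : forall i, 0 < degv R g i 0.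

Local Notation A := (adjmx R g).
Local Notation d i := (degv R g i 0).
Local Notation P := (Pmx R g).
Local Notation Q := (Qmx R g).

Lemma adjmx_sym : A^T = A.
Proof. by apply/matrixP => i j; rewrite !mxE adj_sym. Qed.

Lemma degvE i : d i = \sum_j A i j.
Proof. by rewrite mxE; apply: eq_bigr => j _; rewrite !mxE mulr1. Qed.

Lemma degv_colE j : d j = \sum_i A i j.
Proof. by rewrite degvE; apply: eq_bigr => i _; rewrite -{1}adjmx_sym mxE. Qed.

Lemma PmxE i j : P i j = A i j / d j.
Proof.
pose Di : 'M[R]_n := diag_mx (\row_k (d k)^-1).
have DDi : degmx R g *m Di = 1%:M.
  rewrite /Di /degmx; move: (degv R g) deg_gt0 => x x_gt0.
  rewrite mulmx_diag; apply/matrixP => k l; rewrite !mxE.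
  by rewrite mulfV // gt_eqF.
have Du : degmx R g \in unitmx by case/mulmx1_unit: DDi.
have -> : P = A *m Di by rewrite -[Di](mulKmx Du) DDi mulmx1.
by rewrite mul_mx_diag mxE [in X in _ * X]mxE.
Qed.

Lemma QmxE i j : Q i j = A i j / (Num.sqrt (d i) * Num.sqrt (d j)).
Proof.
pose s := \row_i (Num.sqrt (d i))^-1.
have sE k : s 0 k = (Num.sqrt (d k))^-1 by rewrite mxE.
have -> : Q = diag_mx s *m A *m diag_mx s by [].
by rewrite mul_mx_diag mul_diag_mx [LHS]mxE [X in X * _]mxE !sE invfM; ring.
Qed.

Lemma Qmx_sym : Q^T = Q.
Proof.
by apply/matrixP => i j; rewrite mxE !QmxE -{1}adjmx_sym mxE [X in _ / X]mulrC.
Qed.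

Lemma Pmx_sum (p : 'cV[R]_n) : \sum_i (P *m p) i 0 = \sum_i p i 0.
Proof.
under eq_bigr => i _ do rewrite mxE.
rewrite exchange_big; apply: eq_bigr => j _ /=; rewrite -mulr_suml.
under eq_bigr => i _ do rewrite PmxE.
by rewrite -mulr_suml -degv_colE mulfV ?mul1r // gt_eqF.
Qed.

Lemma Pmx_l1_le (p : 'cV[R]_n) : \sum_i `|(P *m p) i 0| <= \sum_i `|p i 0|.
Proof.
have -> : \sum_i `|p i 0| = \sum_i (P *m map_mx Num.norm p) i 0.
  by rewrite Pmx_sum; apply: eq_bigr => i _; rewrite mxE.
apply: ler_sum => i _; rewrite [X in `|X|]mxE [leRHS]mxE (le_trans (ler_norm_sum _ _ _)) //.
apply: ler_sum => j _; rewrite normrM [X in _ <= _ * X]mxE ler_wpM2r //.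
rewrite ger0_norm // PmxE; apply: divr_ge0; last exact: ltW.
by rewrite mxE.
Qed.

Lemma Pmx_degv : P *m degv R g = degv R g.
Proof.
apply/colP => i; rewrite mxE degvE; apply: eq_bigr => j _.
by rewrite PmxE mulfVK // gt_eqF.
Qed.

Lemma Pmx_tilde_mul (alpha : R) (v p : 'cV[R]_n) : \sum_i p i 0 = 1 ->
  Pmx_tilde alpha v g *m p = alpha *: (P *m p) + (1 - alpha) *: v.
Proof.
move=> p1; rewrite mulmxDl -!scalemxAl -mulmxA.
have -> : (ones R n)^T *m p = 1%:M.
  apply/matrixP => i j; rewrite !ord1 !mxE -p1; apply: eq_bigr => k _.
  by rewrite !mxE mul1r.
by rewrite mulmx1.
Qed.

(** A vector fixed by alpha P has l1-norm at most alpha times itself, because P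
    does not increase the l1-norm. *)
Lemma unit_sub_damped_Pmx (alpha : R) : 0 <= alpha < 1 ->
  1%:M - alpha *: P \in unitmx.
Proof.
move=> /andP [a0 a1]; rewrite -unitmx_tr -row_free_unit -kermx_eq0.
apply/eqP/row_matrixP => k; rewrite row0; set x := row k _.
have : x *m (1%:M - alpha *: P)^T = 0 by apply/sub_kermxP; exact: row_sub.
move=> /(congr1 trmx); rewrite trmx_mul trmxK trmx0 mulmxBl mul1mx -scalemxAl.
move=> /subr0_eq; set p := x^T => pE.
have p_le : \sum_i `|p i 0| <= alpha * \sum_i `|p i 0|.
  rewrite {1}pE (le_trans _ (ler_wpM2l a0 (Pmx_l1_le p))) // mulr_sumr.
  by apply: ler_sum => i _; rewrite mxE normrM (ger0_norm a0).
have p0 : \sum_i `|p i 0| = 0.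
  apply/eqP; rewrite eq_le sumr_ge0 // andbT -(pmulr_rle0 _ (_ : 0 < 1 - alpha)).
    by rewrite mulrBl mul1r subr_le0.
  by rewrite subr_gt0.
apply/rowP => i; rewrite [RHS]mxE.
have /eqP := p0; rewrite psumr_eq0 // => /allP /(_ i).
by rewrite mem_index_enum normr_eq0 mxE => /(_ isT)/eqP.
Qed.

Lemma nonneg_of_l1_le_sum (p : 'cV[R]_n) :
  \sum_i `|p i 0| <= \sum_i p i 0 -> forall i, 0 <= p i 0.
Proof.
move=> le_p i.
have /eqP : \sum_i (`|p i 0| - p i 0) = 0.
  apply/eqP; rewrite eq_le sumrB subr_le0 le_p -sumrB sumr_ge0 // => j _.
  by rewrite subr_ge0 ler_norm.
rewrite psumr_eq0 => [/allP /(_ i)|j _]; last by rewrite subr_ge0 ler_norm.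
by rewrite mem_index_enum subr_eq0 => /(_ isT)/eqP <-.
Qed.

Hypothesis n_gt0 : (0 < n)%N.

Lemma vol_gt0 : 0 < vol R g.
Proof.
rewrite /vol (bigD1 (Ordinal n_gt0)) //= ltr_wpDr ?deg_gt0 //.
by apply: sumr_ge0 => i _; rewrite ltW.
Qed.

(** Existence of a PageRank vector.  For alpha < 1, the solution q of
    q = alpha P q + (1 - alpha) v has mass 1 by comparison of the total masses,
    and l1-norm at most 1 by the triangle inequality; a vector whose l1-norm is at
    most its mass is nonnegative.  For alpha = 1 the matrix I - P is singular and
    the degree distribution is taken instead. *)
Lemma pagerankP (alpha : R) (v : 'cV[R]_n) : 0 <= alpha <= 1 -> prob_vec v ->
  let p := pagerank alpha v g in
  prob_vec p /\ p = alpha *: (P *m p) + (1 - alpha) *: v.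
Proof.
move=> /andP [a0 a1] [v0 v1] /=; set p := pagerank _ _ _.
suff [p_prob pE] : prob_vec p /\ p = Pmx_tilde alpha v g *m p.
  by split; rewrite // {1}pE Pmx_tilde_mul //; case: p_prob.
suff stationary : exists q : 'cV[R]_n, prob_vec q /\ q = Pmx_tilde alpha v g *m q.
  exact: (@xgetPex _ 0 [set q | prob_vec q /\ q = Pmx_tilde alpha v g *m q]).
move: a1; rewrite le_eqVlt => /predU1P [a1|a1].
  exists ((vol R g)^-1 *: degv R g).
  have sum1 : \sum_i ((vol R g)^-1 *: degv R g) i 0 = 1.
    under eq_bigr => i _ do rewrite mxE.
    by rewrite -mulr_sumr mulVf // gt_eqF // vol_gt0.
  split; [split=> // i | rewrite Pmx_tilde_mul //].
    by rewrite mxE mulr_ge0 ?invr_ge0 ?ltW // vol_gt0.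
  by rewrite a1 subrr scale0r addr0 scale1r -scalemxAr Pmx_degv.
have a01 : 0 <= alpha < 1 by rewrite a0.
have oma : 0 < 1 - alpha by rewrite subr_gt0.
pose q := invmx (1%:M - alpha *: P) *m ((1 - alpha) *: v).
have qE : q = alpha *: (P *m q) + (1 - alpha) *: v.
  rewrite -(mulKVmx (unit_sub_damped_Pmx a01) ((1 - alpha) *: v)) -/q.
  by rewrite mulmxBl mul1mx -scalemxAl addrC subrK.
have q1 : \sum_i q i 0 = 1.
  have : \sum_i q i 0 = alpha * \sum_i q i 0 + (1 - alpha).
    rewrite -{2}Pmx_sum -[X in _ = _ + X]mulr1 -{2}v1 {1}qE !mulr_sumr -big_split /=.
    by apply: eq_bigr => i _; rewrite [LHS]mxE; congr (_ + _); rewrite mxE.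
  move=> eq_q; apply: (mulfI (lt0r_neq0 oma)); lra.
have q_le : \sum_i `|q i 0| <= \sum_i q i 0.
  have : \sum_i `|q i 0| <= alpha * \sum_i `|q i 0| + (1 - alpha).
    apply: (@le_trans _ _ (alpha * \sum_i `|(P *m q) i 0| + (1 - alpha))).
      rewrite -[X in _ <= _ + X]mulr1 -{2}v1 {1}qE !mulr_sumr -big_split /=.
      apply: ler_sum => i _; rewrite [X in `|X|]mxE (le_trans (ler_normD _ _)) //.
      have -> : (alpha *: (P *m q)) i 0 = alpha * (P *m q) i 0 by rewrite mxE.
      have -> : ((1 - alpha) *: v) i 0 = (1 - alpha) * v i 0 by rewrite mxE.
      by rewrite !normrM (ger0_norm a0) (gtr0_norm oma) (ger0_norm (v0 i)).
    by rewrite lerD2r ler_wpM2l // Pmx_l1_le.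
  move=> le_q; rewrite q1 -(ler_pM2l oma); lra.
exists q; split; last by rewrite Pmx_tilde_mul.
by split=> //; exact: nonneg_of_l1_le_sum.
Qed.

End Walk.

(** * The deterministic bound on the total variation distance *)

(** Cauchy-Schwarz against the constant vector, by expanding the square and
    using 2ab <= a^2 + b^2 termwise. *)
Lemma sqr_sum_norm_le (R : realFieldType) n (x : 'I_n -> R) :
  (\sum_i `|x i|) ^+ 2 <= n%:R * \sum_i x i ^+ 2.
Proof.
have -> : n%:R * \sum_i x i ^+ 2 =
    \sum_(i < n) \sum_(j < n) (x i ^+ 2 + x j ^+ 2) / 2.
  under [RHS]eq_bigr => i _ do
    rewrite -mulr_suml big_split /= sumr_const card_ord.
  rewrite -mulr_suml big_split /= sumr_const card_ord sumrMnl.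
  by rewrite -[(\sum_i _) *+ n]mulr_natl; field.
rewrite expr2 mulr_suml; apply: ler_sum => i _; rewrite mulr_sumr.
apply: ler_sum => j _; rewrite -(real_normK (num_real (x i))) -(real_normK (num_real (x j))).
have := sqr_ge0 (`|x i| - `|x j|); nra.
Qed.

Lemma norm2_sqr (R : realType) n (x : 'cV[R]_n) : norm2 x ^+ 2 = \sum_i x i 0 ^+ 2.
Proof.
rewrite sqr_sqrtr ?sumr_ge0 //.
by apply: eq_bigr => i _; rewrite real_normK // num_real.
Qed.

Section DegreeRatio.
Variables (R : realType) (n : nat) (g : ugraph n).
Hypothesis deg_gt0 : forall i, 0 < degv R g i 0.
Hypothesis n_gt0 : (0 < n)%N.

Lemma dmin_gt0 : 0 < dmin R g.
Proof.
rewrite /dmin; elim/big_ind: _ => //= [|x y x0 y0]; first by rewrite ltr0n.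
by rewrite lt_min x0.
Qed.

Lemma dmin_le i : dmin R g <= degv R g i 0.
Proof. by rewrite /dmin (bigD1 i) //= ge_min lexx. Qed.

Lemma dmax_ge i : degv R g i 0 <= dmax R g.
Proof. by rewrite /dmax (bigD1 i) //= le_max lexx. Qed.

Variable K : R.
Hypothesis degree_ratio : dmax R g / dmin R g <= K.

Lemma dmax_le : dmax R g <= K * dmin R g.
Proof. by rewrite -ler_pdivrMr // dmin_gt0. Qed.

Lemma degree_ratio_gt0 : 0 < K.
Proof.
apply: lt_le_trans degree_ratio; rewrite divr_gt0 ?dmin_gt0 //.
exact: lt_le_trans (deg_gt0 (Ordinal n_gt0)) (dmax_ge _).
Qed.

(** The volume is at least n times the smallest degree. *)
Lemma stationary_le i : degv R g i 0 / vol R g <= K / n%:R.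
Proof.
have n0 : (0 : R) < n%:R by rewrite ltr0n.
rewrite ler_pdivrMr ?vol_gt0 // mulrAC ler_pdivlMr //.
have volE : n%:R * dmin R g <= vol R g.
  rewrite mulr_natl -[X in _ *+ X](card_ord n) -sumr_const.
  by apply: ler_sum => j _; exact: dmin_le.
apply: le_trans (ler_wpM2l (ltW degree_ratio_gt0) volE).
rewrite mulrC mulrCA ler_pM2l //; exact: le_trans (dmax_ge i) dmax_le.
Qed.

(** With SQ, Sz and Sw the squared 2-norms of Q z, z and w, the bound follows
    from the chain
    4 dTV^2 <= n dmax SQ, SQ <= eps^2 Sz, Sz <= 2 Sw / dmin,
    Sw <= 2 (C^2 + K^2) / n. *)
Lemma pagerank_dTV_le (C eps alpha : R) (v : 'cV[R]_n) :
  0 <= alpha <= 1 -> prob_vec v -> norm2 v <= C / Num.sqrt n%:R ->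
  max_lambda2n R g <= eps -> eps <= 2^-1 ->
  dTV (pagerank alpha v g) (pagerank_limit alpha v g) <=
    eps * Num.sqrt (K * (C ^+ 2 + K ^+ 2)).
Proof.
move=> alpha01 v_prob v_norm gap eps_half.
have [[p_ge0 p1] pE] := pagerankP deg_gt0 n_gt0 alpha01 v_prob.
set p := pagerank alpha v g in p_ge0 p1 pE *.
have [a0 a1] := andP alpha01.
have n0 : (0 : R) < n%:R by rewrite ltr0n.
have K0 := degree_ratio_gt0.
have m0 := dmin_gt0.
move: gap; rewrite ge_max => /andP [gap2 gapn].
have eps0 : 0 <= eps by rewrite (le_trans _ gap2).
pose d i := degv R g i 0.
have d0 i : 0 < d i := deg_gt0 i.
have sd0 i : 0 < Num.sqrt (d i) by rewrite sqrtr_gt0.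
have sdK i : Num.sqrt (d i) ^+ 2 = d i by rewrite sqr_sqrtr // ltW.
pose s : 'cV[R]_n := (vol R g)^-1 *: degv R g.
have sE i : s i 0 = d i / vol R g by rewrite mxE mulrC.
have s1 : \sum_i s i 0 = 1.
  under eq_bigr => i _ do rewrite sE.
  by rewrite -mulr_suml mulfV // gt_eqF // vol_gt0.
have Ps : Pmx R g *m s = s by rewrite -scalemxAr Pmx_degv.
pose y := p - s; pose w := v - s.
have yE : y = alpha *: (Pmx R g *m y) + (1 - alpha) *: w.
  rewrite /y {1}pE mulmxBr Ps; apply/colP => i; rewrite !mxE; ring.
have errE : p - pagerank_limit alpha v g = alpha *: (Pmx R g *m y).
  rewrite {1}pE /y mulmxBr Ps; apply/colP => i.
  by rewrite /pagerank_limit !mxE; ring.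
pose z : 'cV[R]_n := \col_i (y i 0 / Num.sqrt (d i)).
have Qz i : (Qmx R g *m z) i 0 = (Pmx R g *m y) i 0 / Num.sqrt (d i).
  rewrite [LHS]mxE [X in X / _]mxE mulr_suml; apply: eq_bigr => j _.
  rewrite QmxE PmxE // [z _ _]mxE -/(d i) -/(d j) -{3}(sdK j).
  by field; rewrite ?gt_eqF.
pose u : 'cV[R]_n := \col_i Num.sqrt (d i).
have Qu : Qmx R g *m u = u.
  apply/colP => i; rewrite [LHS]mxE [RHS]mxE.
  under eq_bigr => j _.
    rewrite QmxE [u _ _]mxE -/(d i) -/(d j) invfM -mulrA mulfVK ?gt_eqF //.
    over.
  by rewrite -mulr_suml -degvE -/(d i) -{1}sdK expr2 mulfK // gt_eqF.
have u0 : u != 0.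
  apply/eqP => /colP /(_ (Ordinal n_gt0)) /eqP; rewrite !mxE.
  by rewrite gt_eqF // sd0.
(* z is orthogonal to u because pi and s have the same mass. *)
have uz : \sum_i u i 0 * z i 0 = 0.
  have -> : \sum_i u i 0 * z i 0 = \sum_i (p i 0 - s i 0).
    apply: eq_bigr => i _; rewrite [u _ _]mxE [z _ _]mxE mulrC mulfVK ?gt_eqF //.
    by rewrite !mxE.
  by rewrite sumrB p1 s1 subrr.
have eps1 : eps < 1 by lra.
have contract := spectral_gap_contraction (Qmx_sym R g) Qu u0 uz eps1 gap2 gapn.
set Sz := \sum_i z i 0 ^+ 2 in contract; set SQ := \sum_i _ in contract.
pose Sw := \sum_i w i 0 ^+ 2.
have Sw_le : Sw <= 2 * (C ^+ 2 + K ^+ 2) / n%:R.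
  have Sv : \sum_i v i 0 ^+ 2 <= C ^+ 2 / n%:R.
    rewrite -norm2_sqr -[X in _ / X](sqr_sqrtr (ltW n0)) -exprVn -exprMn.
    by rewrite lerXn2r // ?nnegrE ?sqrtr_ge0 // (le_trans _ v_norm) ?sqrtr_ge0.
  have Ss : \sum_i s i 0 ^+ 2 <= K ^+ 2 / n%:R.
    have -> : K ^+ 2 / n%:R = \sum_(i < n) (K / n%:R) ^+ 2.
      by rewrite sumr_const card_ord -mulr_natl; field; rewrite gt_eqF.
    apply: ler_sum => i _; rewrite sE lerXn2r ?nnegrE ?stationary_le //.
      by rewrite divr_ge0 ?ltW // vol_gt0.
    by rewrite divr_ge0 ?ltW.
  have : Sw <= 2 * (\sum_i v i 0 ^+ 2) + 2 * \sum_i s i 0 ^+ 2.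
    rewrite !mulr_sumr -big_split /=; apply: ler_sum => i _.
    have -> : w i 0 = v i 0 - s i 0 by rewrite [LHS]mxE [X in _ + X]mxE.
    have := sqr_ge0 (v i 0 + s i 0); nra.
  by rewrite mulrDr mulrDl -!mulrA; lra.
(* Convexity of the square: z is a convex combination of Q z and D^(-1/2) w. *)
have Sz_le : Sz <= SQ + Sw / dmin R g.
  rewrite /Sw mulr_suml -big_split /=; apply: ler_sum => i _.
  have -> : z i 0 = alpha * (Qmx R g *m z) i 0 +
                    (1 - alpha) * (w i 0 / Num.sqrt (d i)).
    by rewrite Qz [LHS]mxE {1}yE !mxE; ring.
  have h_le : (w i 0 / Num.sqrt (d i)) ^+ 2 <= w i 0 ^+ 2 / dmin R g.
    rewrite expr_div_n sdK ler_wpM2l ?sqr_ge0 // lef_pV2 ?posrE //; exact: dmin_le.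
  apply: le_trans (lerD (lexx _) h_le).
  move: ((Qmx R g *m z) i 0) (w i 0 / Num.sqrt (d i)) => q h.
  have := sqr_ge0 (q - h); have := sqr_ge0 q; have := sqr_ge0 h.
  have : 0 <= alpha * (1 - alpha) by rewrite mulr_ge0 // subr_ge0.
  nra.
have Sz0 : 0 <= Sz by apply: sumr_ge0 => i _; exact: sqr_ge0.
(* Here eps^2 <= 1/2 lets the term SQ <= eps^2 Sz be absorbed on the left. *)
have Sz2 : Sz <= 2 * (Sw / dmin R g).
  have e2 : eps ^+ 2 <= 2^-1 by nra.
  have : eps ^+ 2 * Sz <= 2^-1 * Sz by rewrite ler_wpM2r.
  lra.
have err_le : (\sum_i `|p i 0 - pagerank_limit alpha v g i 0|) ^+ 2 <=
    n%:R * (dmax R g * SQ).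
  apply: le_trans (sqr_sum_norm_le _) _; rewrite ler_pM2l // mulr_sumr.
  apply: ler_sum => i _; rewrite Qz.
  have -> : p i 0 - pagerank_limit alpha v g i 0 = alpha * (Pmx R g *m y) i 0.
    by have /colP/(_ i) := errE; rewrite [LHS]mxE [X in _ + X]mxE [RHS]mxE.
  rewrite exprMn expr_div_n sdK.
  have -> : dmax R g * ((Pmx R g *m y) i 0 ^+ 2 / d i) =
            dmax R g / d i * (Pmx R g *m y) i 0 ^+ 2 by ring.
  rewrite ler_wpM2r ?sqr_ge0 //; apply: (@le_trans _ _ 1); first by nra.
  by rewrite ler_pdivlMr // mul1r dmax_ge.
have R0 : 0 <= eps * Num.sqrt (K * (C ^+ 2 + K ^+ 2)) by rewrite mulr_ge0 ?sqrtr_ge0.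
rewrite -(@ler_pXn2r _ 2) ?nnegrE //; last by rewrite mulr_ge0 ?invr_ge0 ?sumr_ge0.
rewrite /dTV !exprMn sqr_sqrtr; last first.
  by rewrite mulr_ge0 ?addr_ge0 ?sqr_ge0 // ltW.
have SQ_le : n%:R * (dmax R g * SQ) <= 4 * (eps ^+ 2 * (K * (C ^+ 2 + K ^+ 2))).
  have SQm : dmin R g * SQ <= eps ^+ 2 * (2 * Sw).
    apply: le_trans (ler_wpM2l (ltW m0) contract) _.
    rewrite mulrCA ler_wpM2l ?sqr_ge0 // mulrC -ler_pdivlMr // -mulrA.
    exact: Sz2.
  have SQ0 : 0 <= SQ by apply: sumr_ge0 => i _; exact: sqr_ge0.
  have step1 : dmax R g * SQ <= K * (dmin R g * SQ).
    by rewrite mulrA ler_wpM2r // dmax_le.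
  have step2 : K * (dmin R g * SQ) <= K * (eps ^+ 2 * (2 * Sw)).
    by rewrite ler_wpM2l // ltW.
  have nSw : n%:R * Sw <= 2 * (C ^+ 2 + K ^+ 2).
    by rewrite mulrC -ler_pdivlMr.
  have step3 : n%:R * (K * (eps ^+ 2 * (2 * Sw))) <=
      2 * K * eps ^+ 2 * (2 * (C ^+ 2 + K ^+ 2)).
    have -> : n%:R * (K * (eps ^+ 2 * (2 * Sw))) = 2 * K * eps ^+ 2 * (n%:R * Sw).
      by ring.
    by rewrite ler_wpM2l // mulr_ge0 ?sqr_ge0 // mulr_ge0 ?ltW.
  apply: le_trans (_ : n%:R * (K * (eps ^+ 2 * (2 * Sw))) <= _).
    by rewrite ler_pM2l //; apply: le_trans step1 step2.
  by apply: le_trans step3 _; rewrite le_eqVlt; apply/orP; left; apply/eqP; ring.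
rewrite exprVn; lra.
Qed.

End DegreeRatio.

(** * Events that hold with high probability *)

Lemma ugraph_ext n (g h : ugraph n) : (forall i j, g i j = h i j) -> g = h.
Proof.
case: g h => [g g_sym] [h h_sym] /= gh.
have eq_gh : g = h by apply/funext => i; apply/funext => j.
by subst h; rewrite (Prop_irrelevance g_sym h_sym).
Qed.

Section WhpTheory.
Variables (R : realType) (disp : nat -> measure_display).
Variables (Omega : forall n, measurableType (disp n)).
Variables (P : forall n, probability (Omega n) R).

(** The adjacency table determines the graph and takes finitely many values, and
    each value is a finite intersection of edge events or their complements. *)
Lemma measurable_graph_event (G : forall n, Omega n -> ugraph n) :
  random_graph G ->
  forall n (Phi : ugraph n -> Prop), measurable [set w | Phi (G n w)].
Proof.
move=> G_random n Phi.
pose code (g : ugraph n) : {ffun 'I_n * 'I_n -> bool} := [ffun ij => g ij.1 ij.2].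
have -> : [set w | Phi (G n w)] = \bigcup_(f in [set f | exists2 g, Phi g & code g = f])
    \bigcap_(ij in [set: 'I_n * 'I_n]) [set w | G n w ij.1 ij.2 = f ij].
  apply/seteqP; split => [w Phiw | w [f [g Phig <-] gw]] /=.
    by exists (code (G n w)); [exists (G n w) | move=> ij _ /=; rewrite ffunE].
  suff -> : G n w = g by [].
  by apply: ugraph_ext => i j; have := gw (i, j) I; rewrite /= ffunE.
apply: fin_bigcup_measurable => [|f _]; first exact: finite_finset.
apply: fin_bigcap_measurable => [|ij _]; first exact: finite_finset.
case: (f ij); first exact: G_random.
rewrite (_ : [set w | _] = ~` [set w | G n w ij.1 ij.2]).
  by apply: measurableC; exact: G_random.
by apply/seteqP; split => w /=; [move=> ->|move/negP/negbTE].
Qed.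

(** Union bound; the smaller of the two exponents dominates both error terms. *)
Lemma whpI (E F : forall n, set (Omega n)) :
  (forall n, measurable (E n)) -> (forall n, measurable (F n)) ->
  whp P E -> whp P F -> whp P (fun n => E n `&` F n).
Proof.
move=> mE mF [N1 [c1 [C1 [c1_gt0 E_ge]]]] [N2 [c2 [C2 [c2_gt0 F_ge]]]].
exists (maxn N1 N2), (Num.min c1 c2), (`|C1| + `|C2|).
split=> [|n]; first by rewrite lt_min c1_gt0.
rewrite gtn_max => /andP [/[dup] nN1 /E_ge En /F_ge Fn].
have n1 : 1 <= n%:R :> R by rewrite ler1n (leq_ltn_trans _ nN1).
have rate C c : Num.min c1 c2 <= c -> C * n%:R `^ (- c) <= `|C| * n%:R `^ (- Num.min c1 c2).
  move=> le_c; apply: (le_trans (ler_wpM2r (powR_ge0 _ _) (ler_norm C))).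
  by rewrite ler_wpM2l // ler_powR // lerN2.
have r1 := rate C1 c1; have r2 := rate C2 c2.
rewrite !ge_min !lexx ?orbT in r1 r2.
have union_bound : (P n (~` (E n `&` F n)) <= P n (~` E n) + P n (~` F n))%E.
  by rewrite setCI measureU2 //; exact: measurableC.
have mEF : measurable (E n `&` F n) by exact: measurableI.
rewrite !probability_setC // in union_bound.
have fineP X : measurable X -> P n X = (fine (P n X))%:E.
  by move=> mX; rewrite fineK // fin_num_measure.
move: En Fn union_bound; rewrite (fineP _ (mE n)) (fineP _ (mF n)) (fineP _ mEF).
rewrite -!EFinB -EFinD !lee_fin => En Fn union_bound.
have := r1 isT; have := r2 isT; lra.
Qed.

(** Measurability is needed for both events, since a probability is monotone only
    on measurable sets. *)
Lemma whpW (E F : forall n, set (Omega n)) :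
  (forall n, measurable (E n)) -> (forall n, measurable (F n)) ->
  (\forall n \near \oo, E n `<=` F n) -> whp P E -> whp P F.
Proof.
move=> mE mF [N0 _ EF] [N [c [C [c_gt0 E_ge]]]].
exists (maxn N0 N), c, C; split=> // n; rewrite gtn_max => /andP [nN0 nN].
apply: le_trans (E_ge n nN) _; apply: le_measure; rewrite ?inE //.
by apply: EF => /=; exact: ltnW.
Qed.

End WhpTheory.

Theorem theorem1 (R : realType) (disp : nat -> measure_display)
  (Omega : forall n : nat, measurableType (disp n))
  (P : forall n : nat, probability (Omega n) R)
  (G : forall n : nat, Omega n -> ugraph n)
  (G_random : random_graph G)
  (deg_pos : whp P (fun n => [set w | forall i, 0 < degv R (G n w) i 0]))
  (K : R)
  (property1 : whp P (fun n => [set w | dmax R (G n w) / dmin R (G n w) <= K]))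
  (property2 : whp_o1 P (fun n w => max_lambda2n R (G n w)))
  (alpha : R) (alpha01 : 0 <= alpha <= 1)
  (v : forall n : nat, 'cV[R]_n)
  (v_prob : forall n : nat, (0 < n)%N -> prob_vec (v n))
  (v_norm : (fun n : nat => norm2 (v n)) =O_\oo
            (fun n : nat => 1 / Num.sqrt n%:R)) :
  whp_o1 P (fun n w => dTV (pagerank alpha (v n) (G n w))
                           (pagerank_limit alpha (v n) (G n w))).
Proof.
have [psi [psi0 gap_whp]] := property2.
have [C C_norm] : exists C, \forall n \near \oo, norm2 (v n) <= C / Num.sqrt n%:R.
  move/eqOP: v_norm => v_norm.
  near (pinfty_nbhs R) => C; exists C.
  have : \forall n \near \oo, `|norm2 (v n)| <= C * `|1 / Num.sqrt n%:R : R| by near: C.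
  apply: filterS => n; rewrite mul1r normfV !ger0_norm //; exact: sqrtr_ge0.
pose M := Num.sqrt (K * (C ^+ 2 + K ^+ 2)).
exists (fun n => psi n * M); split.
  by rewrite -(mul0r M); apply: cvgM => //; exact: cvg_cst.
have mG := measurable_graph_event G_random.
have good : whp P (fun n =>
    ([set w | forall i, 0 < degv R (G n w) i 0] `&`
     [set w | dmax R (G n w) / dmin R (G n w) <= K]) `&`
     [set w | max_lambda2n R (G n w) <= psi n]).
  apply: (whpI _ _ (whpI _ _ deg_pos property1) gap_whp) => n.
  - exact: (mG n (fun g => (forall i, 0 < degv R g i 0) /\
      dmax R g / dmin R g <= K)).
  - exact: (mG n (fun g => max_lambda2n R g <= psi n)).
  - exact: (mG n (fun g => forall i, 0 < degv R g i 0)).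
  - exact: (mG n (fun g => dmax R g / dmin R g <= K)).
apply: (whpW _ _ _ good) => [n|n|].
- exact: (mG n (fun g => ((forall i, 0 < degv R g i 0) /\
    dmax R g / dmin R g <= K) /\ max_lambda2n R g <= psi n)).
- exact: (mG n (fun g => dTV (pagerank alpha (v n) g)
    (pagerank_limit alpha (v n) g) <= psi n * M)).
have psi_half : \forall n \near \oo, psi n <= 2^-1.
  have half0 : (0 : R) < 2^-1 by [].
  move/cvgrPdist_le : psi0 => /(_ _ half0); apply: filterS => n.
  by rewrite sub0r normrN; apply: le_trans; exact: ler_norm.
near=> n => w [[deg_gt0 ratio] gap] /=.
have n_gt0 : (0 < n)%N by near: n; exact: nbhs_infty_gt.
apply: pagerank_dTV_le => //; first exact: v_prob.
- by near: n.
- by near: n.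
Unshelve. all: by end_near.
Qed.
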